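(* Let $k\ge 3$ and $\ell\ge 2$ be integers and let $\mathcal N=\{N_1,\ldots,N_\ell\}$ be a collection of $k$-element sets, with $V=\bigcup_{i=1}^\ell N_i$, $n=|V|$ and $m=n-k$. Assume: (i) $\bigcap_{i=1}^\ell N_i=\varnothing$, but $\bigcap_{j\ne i}N_j\neq\varnothing$ for every $i=1,\ldots,\ell$; (ii) for every $S\subseteq V$ with $|S|\ge k+1$ there is a $3$-element set $T\subseteq S$ such that $T\not\subseteq N_i$ for all $i=1,\ldots,\ell$. Then $$n\le \binom{m+2}{2}+6m^{5/3}+3m^{4/3}+9m-3.$$
   Context: Condition (i) says the family is minimal with respect to having empty intersection; condition (ii) says that in the $3$-uniform hypergraph on $V$ whose edges are all $3$-subsets of the sets $N_i$, every clique has at most $k$ vertices. *)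

(* Defs.v *)
From mathcomp Require Import all_boot all_order all_algebra.
From mathcomp Require Import all_classical all_reals all_analysis.
Set Implicit Arguments. Unset Strict Implicit. Unset Printing Implicit Defensive.

(* Main.v *)
Require Import Defs.
From mathcomp Require Import all_boot all_order all_algebra.
From mathcomp Require Import all_classical all_reals all_analysis.
From mathcomp Require Import fintype finset lra zify.
Import Order.TTheory GRing.Theory Num.Theory.
Set Implicit Arguments.
Unset Strict Implicit.
Unset Printing Implicit Defensive.

(**
Put [B_i = V \ N_i], a family of [m]-sets covering [V].  By (ii), every set of
fewer than [m] points is disjoint from a triple that meets every [B_i].

Following Szemeredi and Petruska, repeatedly choose a minimal subfamily of the
current [B_i] that still covers the points not used so far, and put a private
point of each of its members [B_i] into a set [X_i].  This gives disjoint sets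
[X_i] included in [B_i] such that [X_i] misses [B_j] whenever
[#|X_i| <= #|X_j|].  Stopping just before a subfamily has at most two members,
all but [2m] points lie in some [X_i].

If [#|D| < #|X_i|], some triple that meets every [B_j] avoids [(B_i \ X_i) u D];
its part outside [X_i] has at most two points, avoids [B_i u D], and meets [B_j]
for all [j != i] with [#|X_j| >= #|X_i|].  Enlarging [D] greedily produces about
[#|X_i|] pairs for each [i], each disjoint from a set [(B_i \ X_i) u D] of size
less than [m], and the skew Bollobas inequality for (2, m-1)-set pairs bounds the
total number by [binom(m+1, 2)].  Deleting [X_i] from [B_i] matters only for pairs
[{x, y}] with [x] in [X_i]; then [y] lies in all but at most two of the [B_j] with
[#|X_j| >= #|X_i|].  Such popular points are put into [D] in advance, which costs
at most [6m] pairs in total.  Hence [n <= binom(m+1, 2) + 8m].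
*)

Definition intersects (T : finType) (A B : {set T}) : bool := ~~ [disjoint A & B].

Lemma intersectsP (T : finType) (A B : {set T}) :
  reflect (exists2 x, x \in A & x \in B) (intersects A B).
Proof.
rewrite /intersects /disjoint.
by apply: (iffP pred0Pn) => [[x /andP[]]|[x xA xB]]; exists x => //; apply/andP.
Qed.

Definition disjoint_pair (T : finType) (a b : nat) (p : {set T} * {set T}) : bool :=
  [&& #|p.1| <= a, #|p.2| <= b & [disjoint p.1 & p.2]].

Definition skew_set_pairs (T : finType) (a b : nat)
    (s : seq ({set T} * {set T})) : bool :=
  all (disjoint_pair a b) s && pairwise (fun p q => intersects p.1 q.2) s.

Lemma prodr_comp (R : comPzSemiRingType) (I J : finType) (f : I -> J) (x : J -> R) :
  (\prod_i x (f i) = \prod_j x j ^+ #|[set i | f i == j]|)%R.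
Proof.
rewrite (partition_big f xpredT) //=; apply: eq_bigr => j _.
rewrite -prodr_const; apply: eq_big => [i|i /eqP->] //.
by rewrite inE.
Qed.

Section ProductsOfLinearForms.
Local Open Scope ring_scope.
Variables (F : fieldType) (r s a b : nat).

(* The product over [l] is a homogeneous polynomial of degree [b] in the [a.+1]
   entries of row [i], and there are [binom(a + b, a)] monomials. *)
Lemma mxrank_prod_mulmx_le (P : 'M[F]_(r, a.+1)) (U : 'I_s -> 'M[F]_(a.+1, b)) :
  (\rank (\matrix_(i, j) \prod_l (P *m U j) i l)%R <= 'C(a + b, a))%N.
Proof.
pose A := [set t : a.+1.-tuple 'I_b.+1 | \sum_(i <- t) i == b]%N.
pose mult (f : {ffun 'I_b -> 'I_a.+1}) : a.+1.-tuple 'I_b.+1 :=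
  [tuple inord #|[set l | f l == k]| | k < a.+1].
have multE f k : tnth (mult f) k = #|[set l | f l == k]| :> nat.
  by rewrite tnth_mktuple inordK // ltnS -[b in (_ <= b)%N]card_ord max_card.
have multA f : mult f \in A.
  rewrite inE big_tuple; under eq_bigr do rewrite multE -sum1dep_card.
  by rewrite -[eqbRHS]card_ord -sum1_card [eqbRHS](partition_big f xpredT).
pose monomials : 'M[F]_(r, #|A|) := \matrix_(i, e)
  \prod_k P i k ^+ tnth (@enum_val _ A e) k.
pose coefs : 'M[F]_(#|A|, s) := \matrix_(e, j)
  \sum_(f | mult f == @enum_val _ A e) \prod_l U j (f l) l.
suff ->: \matrix_(i, j) \prod_l (P *m U j) i l = monomials *m coefs.
  rewrite -card_ord_partitions.
  exact: leq_trans (mxrankM_maxl _ _) (rank_leq_col _).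
apply/matrixP => i j; rewrite !mxE.
under eq_bigr do rewrite mxE.
rewrite bigA_distr_bigA (partition_big mult (mem A)) => [|f _]; last exact: multA.
rewrite big_enum_val; apply: eq_bigr => e _; rewrite !mxE mulr_sumr.
apply: eq_bigr => f /eqP <-; rewrite big_split /= (prodr_comp f (P i)); congr (_ * _).
by apply: eq_bigr => k _; rewrite multE.
Qed.

Lemma mxrank_prod_horner_le (p : 'I_r -> {poly F}) (x : 'I_s -> 'I_b -> F) :
  (forall i, size (p i) <= a.+1)%N ->
  (\rank (\matrix_(i, j) \prod_l (p i).[x j l])%R <= 'C(a + b, a))%N.
Proof.
move=> size_p.
pose U j := Vandermonde a.+1 (\row_l x j l).
suff -> : \matrix_(i, j) \prod_l (p i).[x j l] =
    \matrix_(i, j) \prod_l ((\matrix_i poly_rV (p i)) *m U j) i l.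
  exact: mxrank_prod_mulmx_le.
apply/matrixP => i j; rewrite !mxE; apply: eq_bigr => l _; rewrite mxE.
rewrite (horner_coef_wide _ (size_p i)); apply: eq_bigr => k _.
by rewrite !mxE.
Qed.

End ProductsOfLinearForms.

(* Points of [T] are labelled by distinct rationals and [None], whose label is
   not used by any point, pads the second sets to [b] elements.  The entry
   [(i, j)] vanishes iff the [i]-th first set intersects the [j]-th second set, so
   skewness makes the matrix triangular. *)
Lemma skew_bollobas (T : finType) (a b : nat) (s : seq ({set T} * {set T})) :
  skew_set_pairs a b s -> size s <= 'C(a + b, a).
Proof.
case: s => [//|q0 s0]; set s := q0 :: s0.
move=> /andP[/(all_nthP q0) s_pairs /(pairwiseP q0) s_skew].
pose A (i : 'I_(size s)) := (nth q0 s i).1.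
pose B (i : 'I_(size s)) := (nth q0 s i).2.
have /all_and3[cardA cardB disjAB] i :
    [/\ #|A i| <= a, #|B i| <= b & [disjoint A i & B i]].
  exact/and3P/s_pairs.
pose label (x : option T) : rat := (pickle x)%:R%R.
have label_inj : injective label.
  by move=> x y /eqP; rewrite eqr_nat => /eqP /(pcan_inj pickleK).
pose p i : {poly rat} :=
  (\prod_(c <- [seq label (Some v) | v <- enum (A i)]) ('X - c%:P))%R.
pose x j (l : 'I_b) := label (nth None (map Some (enum (B j))) l).
pose M := (\matrix_(i, j) \prod_l (p i).[x j l])%R.
have M_eq0 i j : (M i j == 0)%R = intersects (A i) (B j).
  rewrite mxE prodf_seq_eq0; apply/hasP/intersectsP => [[l _ /=]|[v vA vB]].
    rewrite -rootE root_prod_XsubC => /mapP[v]; rewrite mem_enum => vA /label_inj xv.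
    exists v; rewrite // -mem_enum -(mem_map Some_inj) -xv mem_nth //.
    by rewrite ltnNge; apply/negP => /(nth_default None); rewrite xv.
  have v_lt : index v (enum (B j)) < size (enum (B j)) by rewrite index_mem mem_enum.
  have v_ltb : index v (enum (B j)) < b by rewrite (leq_trans v_lt) // -cardE.
  exists (Ordinal v_ltb); rewrite ?mem_index_enum //= -rootE root_prod_XsubC.
  rewrite /x (nth_map v) // nth_index ?mem_enum //.
  by rewrite (map_f (label \o Some)) // mem_enum.
have M_unit : M \in unitmx.
  rewrite unitmxE det_trig ?unitfE.
    by apply/prodf_neq0 => i _; rewrite M_eq0 negbK.
  by apply/is_trig_mxP => i j ij; apply/eqP; rewrite M_eq0 s_skew ?inE.
rewrite -(mxrank_unit M_unit); apply: mxrank_prod_horner_le => i.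
by rewrite size_prod_XsubC size_map -cardE ltnS.
Qed.

Lemma exists_subset_card (T : finType) (A : {set T}) (n : nat) :
  n <= #|A| -> exists2 C : {set T}, C \subset A & #|C| = n.
Proof.
rewrite -bin_gt0 -cards_draws => /card_gt0P[C].
by rewrite inE => /andP[CA /eqP cardC]; exists C.
Qed.

Lemma leq_card_bigcup (T I : finType) (P : pred I) (F : I -> {set T}) :
  #|\bigcup_(i | P i) F i| <= \sum_(i | P i) #|F i|.
Proof.
elim/big_rec2: _ => [|i n A _ leAn]; first by rewrite cards0.
by rewrite (leq_trans (leq_card_setU _ _)) // leq_add2l.
Qed.

Lemma leq_card_bigcup_const (T I : finType) (F : I -> {set T}) (J : {set I}) (m : nat) :
  (forall i, #|F i| <= m) -> #|\bigcup_(i in J) F i| <= #|J| * m.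
Proof.
move=> cardF; rewrite -sum_nat_const (leq_trans (leq_card_bigcup _ _)) //.
exact: leq_sum.
Qed.

Lemma sum_card_fibers (T I : finType) (F : I -> {set T}) :
  \sum_i #|F i| = \sum_x #|[set i | x \in F i]|.
Proof.
under eq_bigr do rewrite -sum1_card big_mkcond.
rewrite exchange_big /=; apply: eq_bigr => x _.
by rewrite -big_mkcond sum1dep_card.
Qed.

Lemma card_exchange_lt (T : finType) (A Y D : {set T}) :
  Y \subset A -> #|D| < #|Y| -> #|(A :\: Y) :|: D| < #|A|.
Proof.
move=> YA D_lt; apply: leq_ltn_trans (leq_card_setU _ _) _.
by rewrite cardsDS //; have := subset_leq_card YA; lia.
Qed.

Section SetFamily.
Variables (T I : finType) (B : I -> {set T}).
Implicit Types (X : I -> {set T}) (J : {set I}) (A C D W : {set T}) (i j : I)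
  (q : {set T} * {set T}).

Definition covers W J : bool := W \subset \bigcup_(j in J) B j.

Definition hitting_set J A : bool := [forall j in J, intersects A (B j)].

Definition hitting_sets_avoid (r m : nat) : Prop :=
  forall C, #|C| <= m ->
  exists e : {set T}, [/\ #|e| <= r, [disjoint e & C] & hitting_set setT e].

Definition private W J i : {set T} := (W :&: B i) :\: \bigcup_(j in J :\ i) B j.

Lemma private_neq0 W J i : minset (covers W) J -> i \in J -> private W J i != set0.
Proof.
move=> /minsetP[/subsetP W_J J_min] iJ; apply/set0Pn.
have /subsetPn[w wW w_others] : ~~ covers W (J :\ i).
  by apply/negP => /J_min/(_ (subD1set _ _))/setP/(_ i); rewrite !inE eqxx iJ.
exists w; rewrite !inE w_others wW /=.
have /bigcupP[j jJ wj] := W_J _ wW.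
have [<- //|ji] := eqVneq j i.
by case/bigcupP: w_others; exists j; rewrite // !inE ji.
Qed.

Lemma card_missed_by_few J (d m : nat) :
  (forall i, #|B i| <= m) -> d < #|J| ->
  #|[set y | #|[set j in J | y \notin B j]| <= d]| <= d.+1 * m.
Proof.
move=> cardB /exists_subset_card[K KJ cardK].
rewrite -cardK (leq_trans _ (leq_card_bigcup_const K cardB)) //.
apply/subset_leq_card/subsetP => y; rewrite inE; apply: contraTT => yK.
rewrite -ltnNge -cardK; apply/subset_leq_card/subsetP => j jK.
by rewrite inE (subsetP KJ) //=; apply: contra yK => yB; apply/bigcupP; exists j.
Qed.

Definition above X i : {set I} := [set j | #|X i| <= #|X j|].

Definition top X : {set I} := [set i | [forall j, #|X j| <= #|X i|]].

Definition residue X : {set T} := \bigcup_i B i :\: \bigcup_i X i.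

Definition tower X : Prop :=
  (forall i, X i \subset B i) /\
  (forall i j, j \in above X i :\ i -> [disjoint X i & B j]).

Lemma leq_card_top X i j : i \in top X -> #|X j| <= #|X i|.
Proof. by rewrite inE => /forallP. Qed.

Lemma top_sub_above X i : top X \subset above X i.
Proof. by apply/subsetP => j jtop; rewrite inE leq_card_top. Qed.

Lemma tower_extend X (Y : I -> {set T}) J :
  tower X -> J \subset top X ->
  (forall i, Y i \subset private (residue X) J i) -> (forall i, #|Y i| = (i \in J)) ->
  tower (fun i => X i :|: Y i) /\ forall i, #|X i :|: Y i| = #|X i| + (i \in J).
Proof.
move=> [XB X_disj] /subsetP J_top Y_private cardY.
have YP i y : y \in Y i ->
    [/\ y \notin X i, y \in B i & forall j, j \in J :\ i -> y \notin B j].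
  move=> /(subsetP (Y_private i)); rewrite !inE => /andP[y_others /andP[/andP[yX _] yB]].
  split=> // [|j jJ]; first by apply: contra yX => yX; apply/bigcupP; exists i.
  by apply: contra y_others => yBj; apply/bigcupP; exists j.
have cardXY i : #|X i :|: Y i| = #|X i| + (i \in J).
  rewrite cardsU cardY disjoint_setI0 ?cards0 ?subn0 // disjoint_sym.
  by rewrite disjoints_subset; apply/subsetP => y /YP[yX _ _]; rewrite inE.
split=> //; split=> [i|i j].
  by rewrite subUset XB; apply/subsetP => y /YP[].
rewrite !inE !cardXY => /andP[ji above_ij].
have Xij : #|X i| <= #|X j|.
  by case: (boolP (j \in J)) above_ij => [/J_top/(leq_card_top i)|_]; lia.
rewrite -setI_eq0 setIUl setU_eq0 !setI_eq0 X_disj ?inE ?ji //=.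
rewrite disjoints_subset; apply/subsetP => y yY; rewrite inE.
have [_ _] := YP _ _ yY; apply.
have iJ : i \in J by rewrite -[_ \in _]lt0b -cardY card_gt0; apply/set0Pn; exists y.
rewrite !inE ji; have := leq_card_top j (J_top _ iJ).
by move: above_ij; rewrite iJ; case: (j \in J) => //; lia.
Qed.

Lemma exists_tower_smaller_residue X J :
  tower X -> J \subset top X -> J != set0 -> minset (covers (residue X)) J ->
  exists X', [/\ tower X', top X' = J & residue X' \proper residue X].
Proof.
move=> X_tower J_top J_neq0 J_min.
have /fin_all_exists2[Y Y_private cardY] i :
    exists2 Y : {set T}, Y \subset private (residue X) J i & #|Y| = (i \in J).
  apply: exists_subset_card; case: (boolP (i \in J)) => // iJ.
  by rewrite card_gt0 (private_neq0 J_min).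
have [X'_tower cardX'] := tower_extend X_tower J_top Y_private cardY.
exists (fun i => X i :|: Y i); have /set0Pn[i0 i0J] := J_neq0; split=> //.
- apply/setP => i; rewrite inE; apply/forallP/idP => [/(_ i0)|iJ j]; rewrite !cardX'.
    by rewrite i0J; have := leq_card_top i (subsetP J_top _ i0J); case: (i \in J); lia.
  by rewrite iJ; have := leq_card_top j (subsetP J_top _ iJ); case: (j \in J); lia.
- have /card_gt0P[y yY] : 0 < #|Y i0| by rewrite cardY i0J.
  rewrite properE setDS /=; last first.
    by apply/bigcupsP => i _; rewrite (bigcup_max i) // subsetUl.
  apply/subsetPn; exists y.
    by have := subsetP (Y_private i0) _ yY; rewrite !inE => /and3P[_ /andP[-> ->]].
  rewrite inE negb_and negbK; apply/orP; left.
  by apply/bigcupP; exists i0; rewrite // inE yY orbT.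
Qed.

Lemma exists_tower (n : nat) : n < #|I| ->
  exists X J, [/\ tower X, n < #|top X|, #|J| <= n & covers (residue X) J].
Proof.
move=> n_lt.
suff climb X : tower X -> n < #|top X| -> covers (residue X) (top X) ->
    exists X J, [/\ tower X, n < #|top X|, #|J| <= n & covers (residue X) J].
  have topE : top (fun=> set0) = setT.
    by apply/setP => i; rewrite !inE; apply/forallP.
  apply: (climb (fun=> set0)); rewrite ?topE ?cardsT //.
    by split=> [i|i j _]; rewrite ?sub0set // -setI_eq0 set0I.
  rewrite /covers (eq_bigl xpredT) ?subsetDl // => i.
  by rewrite inE.
have [k] := ubnP #|residue X|; elim: k X => // k IHk X.
rewrite ltnS => res_k X_tower n_top cov.
have [J J_min J_top] := minset_exists cov.
have [J_le|J_gt] := leqP #|J| n; first by exists X, J; split=> //; case/minsetP: J_min.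
have J_neq0 : J != set0 by rewrite -card_gt0 (leq_ltn_trans _ J_gt).
have [X' [X'_tower topX' res_lt]] :=
  exists_tower_smaller_residue X_tower J_top J_neq0 J_min.
apply: (IHk X'); rewrite ?topX' //; first exact: leq_trans (proper_card res_lt) res_k.
by case/minsetP: J_min => covJ _; exact: subset_trans (proper_sub res_lt) covJ.
Qed.

Lemma exists_large_tower (n m : nat) : (forall i, #|B i| <= m) -> n < #|I| ->
  exists X, [/\ tower X, n < #|top X| & #|\bigcup_i B i| <= \sum_i #|X i| + n * m].
Proof.
move=> cardB /exists_tower[X [J [X_tower n_top J_le cov]]]; exists X; split=> //.
rewrite -(cardsID (\bigcup_i X i)) leq_add //.
  exact: leq_trans (subset_leq_card (subsetIr _ _)) (leq_card_bigcup _ _).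
apply: leq_trans (subset_leq_card cov) _.
by rewrite (leq_trans (leq_card_bigcup_const _ cardB)) // leq_mul2r J_le orbT.
Qed.

Definition popular X i : {set T} := [set y | #|[set j in above X i | y \notin B j]| <= 2].

Definition excess X i : {set T} := popular X i :\: B i.

Definition base X i : {set T} := (B i :\: X i) :|: excess X i.

Lemma popular_top X i j : j \in top X -> popular X i \subset popular X j.
Proof.
move=> jtop; apply/subsetP => y; rewrite !inE; apply: leq_trans.
apply/subset_leq_card/subsetP => k; rewrite !inE => /andP[Xjk ->].
by rewrite (leq_trans _ Xjk) // leq_card_top.
Qed.

(* Among the indices [i] with [y] in [excess X i], one with [#|X i|] minimal has
   all the others above it, and they all miss [y]. *)
Lemma card_excess_fiber X y : #|[set i | y \in excess X i]| <= 2.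
Proof.
have [->|/set0Pn[i0]] := eqVneq [set i | y \in excess X i] set0.
  by rewrite cards0.
rewrite inE => y_excess.
case: (@arg_minnP _ i0 (fun i => y \in excess X i) (fun i => #|X i|) y_excess).
move=> i /setDP[+ _] i_min; rewrite inE; apply: leq_trans.
apply/subset_leq_card/subsetP => j; rewrite !inE => jE.
by rewrite i_min ?inE //; case/andP: jE.
Qed.

Lemma sum_card_excess X (m : nat) :
  (forall i, #|B i| <= m) -> 2 < #|top X| -> \sum_i #|excess X i| <= 6 * m.
Proof.
move=> cardB top_gt2.
have /card_gt0P[t t_top] : 0 < #|top X| by apply: leq_trans top_gt2.
have card_popular : #|popular X t| <= 3 * m.
  apply: card_missed_by_few => //; apply: leq_trans top_gt2 _.
  exact/subset_leq_card/top_sub_above.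
rewrite sum_card_fibers.
apply: (@leq_trans (\sum_(y in popular X t) 2)); last by rewrite sum_nat_const; lia.
rewrite [leqRHS]big_mkcond /=; apply: leq_sum => y _.
case: ifP => [_|y_unpopular]; first exact: card_excess_fiber.
rewrite leqn0 cards_eq0 -subset0; apply/subsetP => i; rewrite inE => /setDP[yi _].
by rewrite (subsetP (popular_top i t_top)) in y_unpopular.
Qed.

(* If a point [x] of [A] lies in [X j], then it lies in no other [B k] with [k]
   above [j], so the only other point [y] of [A] lies in all of these except
   possibly [B i], which makes [y] popular. *)
Lemma intersects_base X i j A :
  tower X -> 2 < #|top X| -> #|A| <= 2 ->
  hitting_set (above X i :\ i) A -> j \in above X i :\ i -> intersects A (base X j).
Proof.
move=> [XB X_disj] top_gt2 cardA /forall_inP A_hits jP.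
have /intersectsP[x xA xB] := A_hits _ jP.
apply/intersectsP; have [xX|xX] := boolP (x \in X j); last first.
  by exists x; rewrite // !inE xX xB.
have x_miss k : k \in above X j :\ j -> x \notin B k.
  by move=> /X_disj/disjointFr->.
have above_i k : k \in above X j :\ i -> k \in above X i :\ i.
  by move: jP; rewrite !inE => /andP[_ /leq_trans Xij] /andP[-> /Xij].
have [k0 k0_top /andP[k0i k0j]] : exists2 k, k \in top X & (k != i) && (k != j).
  have : ~~ (top X \subset [set i; j]).
    by apply/negP => /subset_leq_card; rewrite cards2; case: eqP => _ /=; lia.
  by case/subsetPn => k ktop; rewrite !inE negb_or; exists k.
have k0_above r : k0 != r -> k0 \in above X j :\ r.
  by move=> k0r; rewrite in_setD1 k0r (subsetP (top_sub_above X j)).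
have /intersectsP[y yA yB] := A_hits _ (above_i _ (k0_above _ k0i)).
have yx : y != x by apply: contraTneq yB => ->; exact/x_miss/k0_above.
have A_sub z : z \in A -> z != x -> z = y.
  move=> zA zx; have : #|A :\ x| <= 1 by move: cardA; rewrite (cardsD1 x) xA.
  by move/card_le1_eqP; apply; rewrite !inE ?zx ?yx.
have y_popular : y \in popular X j.
  rewrite inE (leq_trans (subset_leq_card (B := [set i; j]) _)) //; last first.
    by rewrite cards2; case: eqP.
  apply/subsetP => k; rewrite inE => /andP[k_above]; apply: contraR.
  rewrite !inE negb_or => /andP[ki kj].
  have /intersectsP[z zA zB] : intersects A (B k).
    by apply/A_hits/above_i; rewrite in_setD1 ki.
  rewrite -(A_sub z) //; apply: contraTneq zB => ->.
  by apply: x_miss; rewrite in_setD1 kj.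
have y_notX : y \notin X j.
  by apply: contraTN yB => yX; rewrite (disjointFr (X_disj _ _ (k0_above _ k0j)) yX).
by exists y; rewrite // !inE y_notX; case: (y \in B j); rewrite // inE in y_popular *.
Qed.

Lemma exists_disjoint_hitting_set X (r m : nat) i D :
  tower X -> #|B i| <= m.+1 -> hitting_sets_avoid r.+1 m -> #|D| < #|X i| ->
  exists A, [/\ #|A| <= r, [disjoint A & B i :|: D] & hitting_set (above X i :\ i) A].
Proof.
move=> [XB X_disj] Bi_le avoid D_lt.
have [|e [e_le e_disj /forall_inP e_hits]] := avoid ((B i :\: X i) :|: D).
  by rewrite -ltnS (leq_trans (card_exchange_lt (XB i) D_lt)).
have e_avoids x : x \in e -> x \notin X i -> x \notin B i :|: D.
  by move=> /(disjointFr e_disj); rewrite !inE => + xX; rewrite xX => ->.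
exists (e :\: X i); split.
- have /intersectsP[x xe xB] := e_hits i (in_setT i).
  have xX : x \in X i by apply: contraTT xB => /(e_avoids x xe); rewrite inE => /norP[].
  rewrite -ltnS (leq_trans _ e_le) // (proper_card (A := e :\: X i)) //.
  by rewrite properE subsetDl; apply/subsetPn; exists x; rewrite // inE xX.
- by rewrite disjoints_subset; apply/subsetP => x /setDP[xe xX]; rewrite inE e_avoids.
- apply/forall_inP => j jP; have /intersectsP[x xe xB] := e_hits j (in_setT j).
  by apply/intersectsP; exists x; rewrite // inE xe (disjointFl (X_disj _ _ jP)).
Qed.

Section HittingTriples.
Variables (X : I -> {set T}) (m : nat).
Hypothesis X_tower : tower X.
Hypothesis top_gt2 : 2 < #|top X|.
Hypothesis cardB : forall i, #|B i| <= m.+1.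
Hypothesis triples : hitting_sets_avoid 3 m.

Lemma exists_skew_pairs i (r : nat) D : r + #|D| <= #|X i| ->
  exists s, [/\ size s = r, skew_set_pairs 2 m s &
    {in s, forall q, hitting_set (above X i :\ i) q.1 /\ (B i :\: X i) :|: D \subset q.2}].
Proof.
elim: r D => [|r IHr] D rD; first by exists [::].
have D_lt : #|D| < #|X i| by apply: leq_trans rD; rewrite addSn ltnS leq_addl.
have [A [A_le2 A_disj A_hits]] :=
  exists_disjoint_hitting_set X_tower (cardB i) triples D_lt.
have [j jP] : exists j, j \in above X i :\ i.
  have /card_gt0P[j] : 0 < #|top X :\ i|.
    by have := cardsD1 i (top X); have := top_gt2; lia.
  by rewrite !inE => /andP[ji /forallP/(_ i) Xij]; exists j; rewrite !inE ji.
have /intersectsP[x xA _] := forall_inP A_hits _ jP.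
have [|s [size_s /andP[s_pairs s_skew] sP]] := IHr (x |: D).
  by rewrite cardsU1; have := leq_b1 (x \notin D); lia.
have [XB _] := X_tower.
exists ((A, (B i :\: X i) :|: D) :: s); split=> [||q].
- by rewrite /= size_s.
- rewrite /skew_set_pairs /= s_pairs s_skew !andbT; apply/andP; split.
    apply/and3P; split=> //=; last by apply: disjointWr A_disj; rewrite setSU ?subsetDl.
    by rewrite -ltnS (leq_trans (card_exchange_lt (XB i) D_lt)).
  apply/allP => q /sP[_ /subsetP q_sub]; apply/intersectsP; exists x => //=.
  by apply: q_sub; rewrite !inE eqxx orbT.
- rewrite inE => /predU1P[-> //|/sP[q_hits q_sub]]; split=> //.
  by apply: subset_trans q_sub; rewrite setUS // subsetUr.
Qed.

Lemma exists_skew_pairs_seq (js : seq I) :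
  pairwise (fun i j => j \in above X i :\ i) js ->
  exists s, [/\ size s = \sum_(i <- js) (#|X i| - #|excess X i|), skew_set_pairs 2 m s &
    {in s, forall q, exists2 i, i \in js & base X i \subset q.2}].
Proof.
elim: js => [_|i js IHjs]; first by exists [::]; rewrite big_nil.
move=> /= /andP[/allP i_js /IHjs[s [size_s /andP[s_pairs s_skew] s_base]]].
have [r [size_r /andP[r_pairs r_skew] rP]] : exists r,
  [/\ size r = #|X i| - #|excess X i|, skew_set_pairs 2 m r &
    {in r, forall q, hitting_set (above X i :\ i) q.1 /\ base X i \subset q.2}].
  have [le_excess|/ltnW/eqP ->] := leqP #|excess X i| #|X i|; last by exists [::].
  by apply: exists_skew_pairs; rewrite subnK.
exists (r ++ s); split=> [||q].
- by rewrite size_cat big_cons size_r size_s.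
- rewrite /skew_set_pairs all_cat pairwise_cat r_pairs r_skew s_pairs s_skew !andbT.
  apply/allrelP => p q p_r /s_base[j j_js /subsetP q_base].
  have [p_hits _] := rP _ p_r; have /and3P[p_le2 _ _] := allP r_pairs _ p_r.
  have /intersectsP[x xp xj] := intersects_base X_tower top_gt2 p_le2 p_hits (i_js _ j_js).
  by apply/intersectsP; exists x; rewrite // q_base.
- rewrite mem_cat => /orP[/rP[_ q_base]|/s_base[j j_js q_base]].
    by exists i; rewrite ?mem_head.
  by exists j; rewrite // inE j_js orbT.
Qed.

Lemma sum_card_sub_excess : \sum_i (#|X i| - #|excess X i|) <= 'C(m.+2, 2).
Proof.
pose shorter i j := #|X i| <= #|X j|.
have shorter_trans : transitive shorter by move=> j i k; apply: leq_trans.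
have shorter_total : total shorter by move=> i j; apply: leq_total.
have [|s [size_s s_skew _]] := exists_skew_pairs_seq (js := sort shorter (enum I)).
  apply: (@sub_pairwise _ [rel i j | (i != j) && shorter i j]).
    by move=> i j /andP[ij Xij]; rewrite !inE eq_sym ij.
  rewrite pairwise_relI -uniq_pairwise sort_uniq enum_uniq.
  by rewrite -sorted_pairwise // sort_sorted.
have := skew_bollobas s_skew; rewrite size_s add2n.
by rewrite (perm_big _ (permEl (perm_sort _ _))) big_enum.
Qed.

End HittingTriples.

Lemma leq_card_bigcup_hitting_triples (m : nat) :
  (forall i, #|B i| <= m.+1) -> hitting_sets_avoid 3 m ->
  #|\bigcup_i B i| <= 'C(m.+2, 2) + 8 * m.+1.
Proof.
move=> cardB triples; have [I_le2|I_gt2] := leqP #|I| 2.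
  rewrite (eq_bigl [in [set: I]]) => [|i]; last by rewrite inE.
  by rewrite (leq_trans (leq_card_bigcup_const _ cardB)) // cardsT; nia.
have [X [X_tower top_gt2 card_V]] := exists_large_tower cardB I_gt2.
have sumX : \sum_i #|X i| <= \sum_i (#|X i| - #|excess X i|) + \sum_i #|excess X i|.
  by rewrite -big_split leq_sum // => i _ /=; lia.
have := sum_card_sub_excess X_tower top_gt2 cardB triples.
by have := sum_card_excess cardB top_gt2; lia.
Qed.

End SetFamily.

Lemma szemeredi_petruska_bound (T I : finType) (N : I -> {set T}) (k : nat) :
  let V := \bigcup_i N i in
  (forall i, #|N i| = k) -> \bigcap_i N i = set0 ->
  (forall S : {set T}, S \subset V -> k < #|S| ->
     exists e : {set T}, [/\ e \subset S, #|e| = 3 & forall i, ~~ (e \subset N i)]) ->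
  #|V| <= 'C((#|V| - k).+1, 2) + 8 * (#|V| - k).
Proof.
move=> V cardN capN clique_free.
have NV i : N i \subset V by apply: bigcup_sup.
have cardVN i : #|V :\: N i| = #|V| - k by rewrite cardsDS // cardN.
have bigcupVN : \bigcup_i (V :\: N i) = V.
  under eq_bigr do rewrite setDE.
  by rewrite -big_distrr /= -setC_bigcap capN setC0 setIT.
rewrite -{1}bigcupVN; case eq_m : (#|V| - k) => [|m].
  by apply: leq_trans (leq_card_bigcup _ _) _; rewrite big1 // => i _; rewrite cardVN.
apply: leq_card_bigcup_hitting_triples => [i|C C_le]; first by rewrite cardVN eq_m.
have [||e [eS card_e eN]] := clique_free (V :\: C); first exact: subsetDl.
  by rewrite cardsD; have := subset_leq_card (subsetIr V C); lia.
exists e; split; first by rewrite card_e.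
  by move: eS; rewrite subsetD => /andP[].
apply/forall_inP => i _; apply/intersectsP; have /subsetPn[x xe xN] := eN i.
by exists x; rewrite // inE xN; have := subsetP eS _ xe; rewrite inE => /andP[].
Qed.

Local Open Scope ring_scope.

Theorem theorem5 (R : realType) (T : finType) (k l : nat) (N : 'I_l -> {set T}) :
  (3 <= k)%N -> (2 <= l)%N ->
  (forall i, #|N i| = k) ->
  \bigcap_(i < l) N i = finset.set0 ->
  (forall i : 'I_l, \bigcap_(j < l | j != i) N j != finset.set0) ->
  (forall S : {set T}, S \subset \bigcup_(i < l) N i -> (k.+1 <= #|S|)%N ->
     exists Tr : {set T}, [/\ Tr \subset S, #|Tr| = 3%N &
       forall i : 'I_l, ~~ (Tr \subset N i)]) ->
  let n := #|\bigcup_(i < l) N i| in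
  let m : R := (n - k)%N%:R in
  (n%:R : R) <= 'C((n - k).+2, 2)%:R
      + 6 * powR m (5%:R / 3%:R) + 3 * powR m (4%:R / 3%:R) + 9 * m - 3.
Proof.
move=> k_ge3 l_ge2 cardN capN _ clique_free; cbv zeta.
set n := #|_|; set m : R := (n - k)%:R.
have n_le : (n <= 'C((n - k).+1, 2) + 8 * (n - k))%N.
  exact: szemeredi_petruska_bound cardN capN clique_free.
have n_ge3 : (3 <= n)%N.
  rewrite (leq_trans k_ge3) // -(cardN (Ordinal (ltnW l_ge2))) subset_leq_card //.
  exact: bigcup_sup.
have m_ge1 : 1 <= m.
  rewrite ler1n lt0n; apply: contraTneq n_le => ->.
  by rewrite -ltnNge (leq_trans _ n_ge3).
have m_le_powR53 : m <= powR m (5%:R / 3%:R) by apply: le1r_powR => //; lra.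
have m_le_powR43 : m <= powR m (4%:R / 3%:R) by apply: le1r_powR => //; lra.
have {}n_le : n%:R <= 'C((n - k).+1, 2)%:R + 8 * m by rewrite -natrM -natrD ler_nat.
rewrite binS bin1 natrD -natr1 -/m.
by move: n_le m_ge1 m_le_powR53 m_le_powR43; set x := powR _ _; set y := powR _ _; lra.
Qed.
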